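(* Let $H$ be a complex Hilbert space with bounded operators $\mathcal B(H)$, and let $L$ be a strongly closed complex linear subspace of $\mathcal B(H)$. Let $L_{\mathrm{sa}}$ be the real vector space that consists of the self-adjoint elements of $L$, supplied with the partial ordering inherited from the usual partial ordering on the self-adjoint elements $\mathcal B(H)_{\mathrm{sa}}$ of $\mathcal B(H)$. Let $X$ be a set, let $\Omega$ be an algebra of subsets of $X$, let $\mu:\Omega\to L_{\mathrm{sa}}^+$ be a map such that $\mu(\emptyset)=0$, and let $(\Delta_n)_{n=1}^\infty\subseteq\Omega$ be such that $\bigcup_{n=1}^\infty\Delta_n\in\Omega$. Then the following are equivalent: (1) $\mu\big(\bigcup_{n=1}^\infty\Delta_n\big)=\bigvee_{N=1}^\infty\sum_{n=1}^N\mu(\Delta_n)$ in $L_{\mathrm{sa}}$; (2) $\mu\big(\bigcup_{n=1}^\infty\Delta_n\big)x=\sum_{n=1}^\infty\mu(\Delta_n)x$ in the norm topology of $H$ for all $x\in H$.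
   Context: The usual partial ordering on $\mathcal B(H)_{\mathrm{sa}}$: $S\le T$ iff $\langle (T-S)x,x\rangle\ge0$ for all $x\in H$. $L_{\mathrm{sa}}^+$ is the set of positive elements of $L_{\mathrm{sa}}$. ''Strongly closed'' means closed in the strong operator topology. The symbol $\bigvee$ denotes the supremum in the partially ordered set $L_{\mathrm{sa}}$; (1) asserts that this supremum exists and equals the left hand side. *)

(* Defs.v *)
From HB Require Import structures.
From mathcomp Require Import all_boot all_order all_algebra.
From mathcomp Require Import complex.
From mathcomp Require Import all_classical all_reals all_analysis.

Set Implicit Arguments.
Unset Strict Implicit.
Unset Printing Implicit Defensive.

Import Order.TTheory GRing.Theory Num.Theory.
Import numFieldNormedType.Exports.

Local Open Scope classical_set_scope.
Local Open Scope ring_scope.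

Section bounded_operators.
Context {K : numFieldType} (V : normedModType K).

Definition bounded_linear : {pred V -> V} :=
  mem [set f | linear f /\ bounded_near f (nbhs (0 : V))].

Record bounded_op := BoundedOp {
  bop_fun :> V -> V;
  bop_funP : bop_fun \in bounded_linear }.

HB.instance Definition _ := [isSub for bop_fun].
HB.instance Definition _ := [Choice of bounded_op by <:].

Lemma bounded_linear_submod_closed :
  GRing.submod_closed bounded_linear.
Proof.
split.
  apply/mem_set; split; first by move=> a u v /=; rewrite scaler0 addr0.
  apply/ex_bound; exists 0; apply: nearW => x /=.
  by rewrite (_ : (0 : V -> V) x = 0) ?normr0.
move=> a f g /set_mem[lf bf] /set_mem[lg bg]; apply/mem_set; split.
  move=> b u v /=.
  have E x : (a *: f + g) x = a *: f x + g x by [].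
  by rewrite !E lf lg !scalerDr !scalerA mulrC !addrA; congr (_ + _); rewrite addrAC.
have [M /= fM] := (ex_bound _).1 bf; have [N /= gN] := (ex_bound _).1 bg.
apply/ex_bound; exists (`|a| * M + N); near=> x => /=.
have -> : (a *: f + g) x = a *: f x + g x by [].
rewrite (le_trans (ler_normD _ _))// normrZ lerD//; last by near: x.
by rewrite ler_wpM2l//; near: x.
Unshelve. all: by end_near. Qed.

HB.instance Definition _ := GRing.isSubmodClosed.Build K (V -> V)
  bounded_linear bounded_linear_submod_closed.
HB.instance Definition _ := [SubChoice_isSubLmodule of bounded_op by <:].

Definition strong_operator_topology : Type :=
  initial_topology (bop_fun : bounded_op -> {ptws V -> V}).

HB.instance Definition _ := Topological.on strong_operator_topology.

Definition strongly_closed (L : set bounded_op) :=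
  closed (L : set strong_operator_topology).

End bounded_operators.

Section operators_on_Hilbert_space.
Context {R : realType} {H : completeNormedModType R[i]}.
(* {dot H for _} is linear in its first argument and conjugate-linear in its
   second one *)
Variable ip : {dot H for @Num.conj R[i]}.

Definition is_adjoint (T S : bounded_op H) :=
  forall x y : H, ip (T x) y = ip x (S y).

Definition selfadjoint : set (bounded_op H) := [set T | is_adjoint T T].

(* in R[i], 0 <= z means that z is real and nonnegative *)
Definition op_le (S T : bounded_op H) :=
  forall x : H, 0 <= ip ((T - S) x) x.

Definition sa_part (L : set (bounded_op H)) : set (bounded_op H) :=
  L `&` selfadjoint.

Definition sa_positive (L : set (bounded_op H)) : set (bounded_op H) :=
  [set T | sa_part L T /\ op_le 0 T].

(* S is the supremum of A in the poset P ordered by op_le: upper bounds that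
   are not in P do not count *)
Definition is_supremum_in (P A : set (bounded_op H)) (S : bounded_op H) :=
  [/\ P S, forall T, A T -> op_le T S &
      forall U, P U -> (forall T, A T -> op_le T U) -> op_le S U].

End operators_on_Hilbert_space.

(* algebraOfSetsType is not used because it excludes the empty set X *)
Definition set_algebra (X : Type) (Omega : set (set X)) :=
  [/\ Omega set0, setC_closed Omega & setU_closed Omega].

(* Main.v *)
Require Import Defs.
From HB Require Import structures.
From mathcomp Require Import all_boot all_order all_algebra.
From mathcomp Require Import complex.
From mathcomp Require Import all_classical all_reals all_analysis.
From mathcomp Require Import ring.

Set Implicit Arguments.
Unset Strict Implicit.
Unset Printing Implicit Defensive.

Import Order.TTheory GRing.Theory Num.Theory.
Import numFieldNormedType.Exports.

Local Open Scope classical_set_scope.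
Local Open Scope ring_scope.

(** Write [S_N] for the partial sums of the positive operators [mu (Delta n)]
    and [T] for the value of [mu] on the union.

    From (2) to (1): if [S_N x] converges to [T x] for all [x], then
    [<S_N x, x>] converges to [<T x, x>], and it increases with [N]. Hence
    [S_N <= T] for all [N], and [T <= U] for each operator [U] that is above
    all [S_N] ([le_limit_op], [limit_le_op]).

    From (1) to (2), the main point is that an increasing sequence of
    self-adjoint operators that is bounded above converges strongly. If
    [P] is self-adjoint and [0 <= P <= c], then [|P x|^2 <= c <P x, x>] ([positive_norm_le]). Applied to
    the differences [S_n - S_m], which lie between [0] and [T], this reduces the
    Cauchy property of [S_N x] to that of the increasing bounded sequence of
    real numbers [<S_N x, x>] ([cauchy_psum]). The pointwise limit [S] of the
    [S_N] is a bounded operator ([psum_cvg]); it is self-adjoint, and it is in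
    [L] because [L] is strongly closed. So [S] is an upper bound of the [S_N]
    that competes with [T] in [L_sa], and [T <= S] as [T] is the least one.
    Conversely [S <= T], as a limit of operators below [T]. The order is
    antisymmetric on self-adjoint operators ([op_le_anti]), so [S = T]. *)

(** * Cauchy-Schwarz inequality and limits of sequences *)

(** The usual projection argument in a form without division: the square norm
    of [<v, v> u - <u, v> v] is [<v, v> (<u, u> <v, v> - |<u, v>|^2)]. *)
Lemma dot_CauchySchwarz (C : numClosedFieldType) (U : lmodType C)
    (form : {dot U for @Num.conj C}) (u v : U) :
  `|form u v| ^+ 2 <= form u u * form v v.
Proof.
have [->|v0] := eqVneq v 0; first by rewrite linear0r normr0 expr0n mulr_ge0 ?dnorm_ge0.
have v_gt0 : 0 < form v v by rewrite dnorm_gt0.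
rewrite -subr_ge0 -(pmulr_rge0 _ v_gt0).
have := dnorm_ge0 form (form v v *: u - form u v *: v).
have vR : (form v v)^* = form v v by apply/CrealP/ger0_real/ltW.
have E a b : form (a *: u) (b *: v) = a * (b^* * form u v).
  by rewrite linearZl_LR linearZr_LR.
rewrite dnormB !dnormZ E !normCK !rmorphM/= vR conjCK.
set a := form u u; set b := form v v; set c := form u v => h.
by rewrite (_ : _ * _ = b * b * a + c * c^* * b - (b * (c^* * c) + b * (c * c^*))) //; ring.
Qed.

Lemma cvgn_unique (K : numFieldType) (V : pseudoMetricNormedZmodType K)
  (u : V ^nat) (l m : V) : u @ \oo --> l -> u @ \oo --> m -> l = m.
Proof. by move=> ul um; exact: (cvg_unique (@norm_hausdorff _ _) ul um). Qed.

(** The order of [K], for instance that of [R[i]], may be partial, and then it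
    does not define the topology. But [0 <= a] says that [`|a| = a], and the
    norm is continuous. *)
Lemma cvg_ge0 (K : numFieldType) (u : K ^nat) (a : K) :
  (forall n, 0 <= u n) -> u @ \oo --> a -> 0 <= a.
Proof.
move=> u0 ua; apply/normr_idP/(cvg_unique (@norm_hausdorff _ _) _ ua).
by rewrite (_ : u = (fun n => `|u n|)); [exact: cvg_norm|apply/funext => n; rewrite ger0_norm].
Qed.

Lemma squeeze_norm (K : numFieldType) (V W : pseudoMetricNormedZmodType K) (C : K)
    (u : V ^nat) (l : V) (v : W ^nat) (m : W) :
  0 < C -> (forall n, `|m - v n| <= C * `|l - u n|) ->
  u @ \oo --> l -> v @ \oo --> m.
Proof.
move=> C0 h /cvgrPdist_lt ul; apply/cvgrPdist_lt => e e0.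
have := ul (e / C) (divr_gt0 e0 C0); apply: filterS => n.
by rewrite ltr_pdivlMr// mulrC; exact: le_lt_trans.
Qed.

(** * Bounded operators and their pointwise limits *)

Section pointwise_limits.
Context {K : numFieldType} {V : normedModType K}.
Implicit Types T S : bounded_op V.

Lemma bop_linear T : linear T.
Proof. by have /set_mem[] := bop_funP T. Qed.

HB.instance Definition _ T := GRing.isLinear.Build K V V *:%R T (bop_linear T).

Lemma bop_bound T : exists2 M : K, 0 < M & forall x, `|T x| <= M * `|x|.
Proof.
have /set_mem[_ /(linear_boundedP (T : {linear V -> V}))bT] := bop_funP T.
near (+oo : set_system K) => M; exists M; near: M => //.
exact: nbhs_pinfty_gt.
Unshelve. all: by end_near. Qed.

Lemma bop_sumE (A : nat -> bounded_op V) m n x :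
  (\sum_(m <= k < n) A k) x = \sum_(m <= k < n) A k x.
Proof.
by elim/big_rec2: _ => // k y1 y2 _ <-.
Qed.

(** Linearity passes to pointwise limits by uniqueness of limits; the common
    bound [C], which also bounds the limit, gives continuity. *)
Lemma bop_limit (A : nat -> bounded_op V) (f : V -> V) (C : K) :
  0 <= C -> (forall n x, `|A n x| <= C * `|x|) ->
  (forall x, A ^~ x @ \oo --> f x) -> exists S : bounded_op V, S =1 f.
Proof.
move=> C0 AC Af.
have fP : f \in bounded_linear (V:=V).
  apply/mem_set; split => [a u v|].
    apply: (cvg_unique (@norm_hausdorff _ _) (Af _)).
    rewrite (_ : A ^~ _ = (fun n => a *: A n u + A n v)).
      by apply: cvgD => //; exact: cvgZl_tmp.
    by apply/funext => n; rewrite linearP.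
  apply/ex_bound; exists C; near=> x => /=.
  apply: (@le_trans _ _ (C * `|x|)).
    rewrite -subr_ge0; apply: (@cvg_ge0 _ (fun n => C * `|x| - `|A n x|)).
      by move=> n; rewrite subr_ge0.
    by apply: cvgB; [exact: cvg_cst|exact: cvg_norm].
  by rewrite ler_piMr//; near: x; exact: nbhs0_le.
by exists (BoundedOp fP).
Unshelve. all: by end_near. Qed.

(** The strong operator topology is induced by the topology of pointwise
    convergence, so that pointwise convergence of operators is convergence in
    it. *)
Lemma strongly_closed_cvg (L : set (bounded_op V)) (A : nat -> bounded_op V) S :
  strongly_closed L -> (forall n, L (A n)) ->
  (forall x, A ^~ x @ \oo --> S x) -> L S.
Proof.
move=> Lcl LA AS.
apply: (@closed_cvg _ (strong_operator_topology V) \oo _ A L Lcl).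
  exact: nearW.
move=> U [_ [[B Bop <-] BS BU]].
have h : {ptws, (A : nat -> V -> V) @ \oo --> (S : V -> V)} by apply/pointwise_cvgP.
have /h hB : nbhs (S : {ptws V -> V}) B.
  exact: (@open_nbhs_nbhs {ptws V -> V} S B (conj Bop BS)).
exact: (@filterS _ (A @ \oo) _ (bop_fun (V:=V) @^-1` B) U BU hB).
Qed.

End pointwise_limits.

(** * The order on self-adjoint operators *)

Section hilbert.
Context {R : realType} {H : completeNormedModType R[i]}.
Variable ip : {dot H for @Num.conj R[i]}.
Hypothesis ip_norm : forall x : H, `|x| ^+ 2 = ip x x.
Implicit Types (S T P : bounded_op H) (A : nat -> bounded_op H).

Lemma ip_le x y : `|ip x y| <= `|x| * `|y|.
Proof.
rewrite -ler_sqr ?nnegrE ?mulr_ge0// exprMn !ip_norm.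
exact: dot_CauchySchwarz.
Qed.

Lemma ipBl x y z : ip (x - y) z = ip x z - ip y z.
Proof. exact: linearBl. Qed.

Lemma ipBr x y z : ip z (x - y) = ip z x - ip z y.
Proof. exact: linearBr. Qed.

Lemma ipZl a x y : ip (a *: x) y = a * ip x y.
Proof. by rewrite linearZl_LR. Qed.

Lemma ipZr a x y : ip x (a *: y) = a^* * ip x y.
Proof. by rewrite linearZr_LR. Qed.

Lemma cvg_ipl (u : H ^nat) l y : u @ \oo --> l -> ip (u n) y @[n --> \oo] --> ip l y.
Proof.
apply: (@squeeze_norm _ _ _ (`|y| + 1)) => [|n]; first by rewrite ltr_wpDl.
by rewrite -ipBl (le_trans (ip_le _ _))// mulrC ler_wpM2r// lerDl.
Qed.

Lemma cvg_ipr (u : H ^nat) l y : u @ \oo --> l -> ip y (u n) @[n --> \oo] --> ip y l.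
Proof.
apply: (@squeeze_norm _ _ _ (`|y| + 1)) => [|n]; first by rewrite ltr_wpDl.
by rewrite -ipBr (le_trans (ip_le _ _))// ler_wpM2r// lerDl.
Qed.

Lemma op_leE S T : op_le ip S T <-> forall x, ip (S x) x <= ip (T x) x.
Proof.
by split => h x; have := h x; rewrite (_ : (T - S) x = T x - S x)// ipBl subr_ge0.
Qed.

Lemma op_ge0E T : op_le ip 0 T <-> forall x, 0 <= ip (T x) x.
Proof.
by split => [/op_leE|] h; [move=> x|apply/op_leE => x];
  have := h x; rewrite (_ : (0 : bounded_op H) x = 0)// linear0l.
Qed.

Lemma positive_ip_le T M : op_le ip 0 T -> (forall x, `|T x| <= M * `|x|) ->
  forall x, ip (T x) x <= M * `|x| ^+ 2.
Proof.
move=> /op_ge0E T0 TM x; rewrite -[leLHS]ger0_norm//.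
by rewrite (le_trans (ip_le _ _))// expr2 mulrA ler_wpM2r.
Qed.

(** This replaces the Cauchy-Schwarz inequality for the form [<P x, y>]: expand
    [0 <= <P z, z>] at [z = x - c^-1 P x]. As [P] is self-adjoint, both cross
    terms are [- c^-1 |P x|^2], and the quadratic term [c^-2 <P (P x), P x>]
    is at most [c^-1 |P x|^2], so that [0 <= <P x, x> - c^-1 |P x|^2]. *)
Lemma positive_norm_le P (c : R[i]) : 0 < c -> is_adjoint ip P P ->
  (forall x, 0 <= ip (P x) x <= c * `|x| ^+ 2) ->
  forall x, `|P x| ^+ 2 <= c * ip (P x) x.
Proof.
move=> c0 Psa Pc x.
have cR : (c^-1)^* = c^-1 by apply/CrealP; rewrite ger0_real// invr_ge0 ltW.
pose y := c^-1 *: P x.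
have Ey u : ip u y = c^-1 * ip u (P x) by rewrite ipZr cR.
have EPy u : ip (P y) u = c^-1 * ip (P (P x)) u.
  by rewrite (linearZ_LR (P : {linear H -> H})) ipZl.
have /andP[+ _] := Pc (x - y).
rewrite (linearB (P : {linear H -> H})) ipBl !ipBr !Ey !EPy.
rewrite (Psa (P x) x) -!ip_norm.
have /andP[_] := Pc (P x).
set t := `|P x| ^+ 2; set p := ip (P x) x; set q := ip (P (P x)) (P x) => qt h.
have : 0 <= p - c^-1 * t.
  apply: le_trans h _.
  rewrite -subr_ge0 (_ : _ - _ = c^-1 * (t - c^-1 * q)); last by ring.
  apply: mulr_ge0; first by rewrite invr_ge0 ltW.
  by rewrite subr_ge0 ler_pdivrMl.
by rewrite subr_ge0 ler_pdivrMl.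
Qed.

Lemma positive_eq0 P : is_adjoint ip P P -> (forall x, ip (P x) x = 0) ->
  forall x, P x = 0.
Proof.
move=> Psa P0 x; apply/eqP; rewrite -normr_eq0 -sqrf_eq0 eq_le exprn_ge0// andbT.
rewrite -(mulr0 1) -(P0 x); apply: positive_norm_le => // y.
by rewrite P0 mul1r lexx exprn_ge0.
Qed.

Lemma op_le_anti S T : selfadjoint ip S -> selfadjoint ip T ->
  op_le ip S T -> op_le ip T S -> S = T.
Proof.
move=> Ssa Tsa /op_leE ST /op_leE TS.
have E x : (S - T) x = S x - T x by [].
apply/val_inj/funext => x; apply/eqP; rewrite -subr_eq0 -E; apply/eqP.
apply: positive_eq0 => [u v|u]; first by rewrite !E ipBl ipBr Ssa Tsa.
by rewrite E ipBl; apply/eqP; rewrite subr_eq0 eq_le TS ST.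
Qed.

Lemma selfadjoint_sum A (r : seq nat) :
  (forall n, selfadjoint ip (A n)) -> selfadjoint ip (\sum_(k <- r) A k).
Proof.
move=> Asa; elim/big_rec: _ => [u v|k S _ Ssa u v].
  by rewrite -[(0 : bounded_op H) u]/0 -[(0 : bounded_op H) v]/0 linear0l linear0r.
have E x : (A k + S) x = A k x + S x by [].
by rewrite !E linearDl linearDr /= Asa Ssa.
Qed.

Lemma selfadjoint_limit A S : (forall n, selfadjoint ip (A n)) ->
  (forall x, A ^~ x @ \oo --> S x) -> selfadjoint ip S.
Proof.
move=> Asa AS x y.
apply: (@cvgn_unique _ _ (fun n => ip (A n x) y)); first exact: cvg_ipl.
rewrite (_ : (fun n => _) = (fun n => ip x (A n y))); first exact: cvg_ipr.
by apply/funext => n; rewrite Asa.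
Qed.

Lemma limit_le_op A S T : (forall n, op_le ip (A n) T) ->
  (forall x, A ^~ x @ \oo --> S x) -> op_le ip S T.
Proof.
move=> AT AS; apply/op_leE => x; rewrite -subr_ge0.
apply: (@cvg_ge0 _ (fun n => ip (T x) x - ip (A n x) x)).
  by move=> n; rewrite subr_ge0; move/op_leE: (AT n).
by apply: cvgB; [exact: cvg_cst|exact: cvg_ipl].
Qed.

(** The tail of the sequence from index [m] on has the same limit, and all its
    terms are above [A m]. *)
Lemma le_limit_op A S : (forall m n, (m <= n)%N -> op_le ip (A m) (A n)) ->
  (forall x, A ^~ x @ \oo --> S x) -> forall m, op_le ip (A m) S.
Proof.
move=> Amono AS m; apply/op_leE => x; rewrite -subr_ge0.
apply: (@cvg_ge0 _ (fun n => ip (A (m + n)%N x) x - ip (A m x) x)).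
  by move=> n; rewrite subr_ge0; move: x; apply/op_leE/Amono/leq_addr.
apply: cvgB; last exact: cvg_cst.
apply: cvg_ipl; have := AS x; rewrite -(cvg_shiftn m).
by under eq_fun do rewrite addnC.
Qed.

(** * Bounded series of positive operators converge strongly *)

Section positive_series.
Variables (A : nat -> bounded_op H) (T : bounded_op H).
Hypothesis A_sa : forall n, selfadjoint ip (A n).
Hypothesis A_ge0 : forall n, op_le ip 0 (A n).
Local Notation psum n := (\sum_(0 <= k < n) A k).

Lemma ip_sum m n x : ip ((\sum_(m <= k < n) A k) x) x = \sum_(m <= k < n) ip (A k x) x.
Proof. by rewrite bop_sumE linear_sumlz. Qed.

Lemma psum_nondecreasing m n : (m <= n)%N -> op_le ip (psum m) (psum n).
Proof.
move=> mn; apply/op_leE => x; rewrite !ip_sum (big_cat_nat _ mn)//= lerDl.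
by apply: sumr_ge0 => k _; move/op_ge0E: (A_ge0 k).
Qed.

Hypothesis psum_le : forall n, op_le ip (psum n) T.

Lemma bound_ge0 : op_le ip 0 T.
Proof. by have := psum_le 0; rewrite big_geq. Qed.

(** A sum over an interval of indices is positive, and it is below a partial
    sum, hence below [T] (or zero, if the interval is empty): a bound for [T] serves as the constant [c] of
    [positive_norm_le] for all intervals at once. *)
Lemma interval_sum_bound : exists2 M : R[i], 0 < M & forall m n x,
  `|(\sum_(m <= k < n) A k) x| ^+ 2 <= M * \sum_(m <= k < n) ip (A k x) x.
Proof.
have [M M0 TM] := bop_bound T; exists M => // m n x.
rewrite -ip_sum; apply: positive_norm_le => //; first exact: selfadjoint_sum.
move=> y; rewrite ip_sum; apply/andP; split.
  by apply: sumr_ge0 => k _; move/op_ge0E: (A_ge0 k).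
apply: (@le_trans _ _ (ip (T y) y)).
  move/op_leE: (psum_le n) => /(_ y); apply: le_trans; rewrite ip_sum.
  have [mn|/ltnW nm] := leqP m n; last first.
    by rewrite big_geq//; apply: sumr_ge0 => k _; move/op_ge0E: (A_ge0 k).
  rewrite [leRHS](big_cat_nat _ mn)//= lerDr.
  by apply: sumr_ge0 => k _; move/op_ge0E: (A_ge0 k).
exact: positive_ip_le bound_ge0 TM y.
Qed.

(** The numbers [<A k x, x>] are nonnegative complex numbers, and the monotone
    convergence theorem is about real ones; so it is applied to their real
    parts [r k], which lose nothing. *)
Lemma cauchy_psum x : cauchy (series (fun n => A n x) @ \oo).
Proof.
have [M M0 AM] := interval_sum_bound.
have q0 k : 0 <= ip (A k x) x by move/op_ge0E: (A_ge0 k).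
pose r k : R := complex.Re (ip (A k x) x).
have rE k : (r k)%:C%C = ip (A k x) x by rewrite /r RRe_real ?ger0_real.
have sumE m n : \sum_(m <= k < n) ip (A k x) x = (\sum_(m <= k < n) r k)%:C%C.
  by rewrite rmorph_sum; apply: eq_bigr => k _; rewrite -rE.
have : cvgn (series r).
  apply: nondecreasing_is_cvgn.
    apply: nondecreasing_series => k _ _; by have := q0 k; rewrite -rE lecR.
  exists (complex.Re (ip (T x) x)) => _ [n _ <-].
  have := psum_le n; move/op_leE => /(_ x); rewrite ip_sum sumE.
  by rewrite lecE => /andP[].
move=> /cvg_cauchy/cauchy_seriesP rC.
apply/cauchy_seriesP => e e0.
have e2M : 0 < e ^+ 2 / M by rewrite divr_gt0 ?exprn_gt0.
have eE : (complex.Re (e ^+ 2 / M))%:C%C = e ^+ 2 / M by rewrite RRe_real ?gtr0_real.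
have : 0 < complex.Re (e ^+ 2 / M) by rewrite -ltcR eE.
move=> /rC; apply: filterS => -[m n] /= rmn.
rewrite -(@ltr_pXn2r _ 2%N) ?nnegrE ?(ltW e0)// -bop_sumE.
rewrite (le_lt_trans (AM _ _ _))// sumE -ltr_pdivlMl// mulrC -eE ltcR.
exact: le_lt_trans (ler_norm _) rmn.
Qed.

Lemma psum_cvg : exists S : bounded_op H, forall x, (fun n => psum n x) @ \oo --> S x.
Proof.
have [M M0 AM] := interval_sum_bound.
have [N N0 TN] := bop_bound T.
have c x : cvgn (series (fun n => A n x)) by apply/cauchy_cvgP/cauchy_psum.
have c' x : (fun n => psum n x) @ \oo --> limn (series (fun n => A n x)).
  rewrite (_ : (fun n => _) = series (fun n => A n x)); first exact: c.
  by apply/funext => n; rewrite bop_sumE.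
(* |S_n x|^2 <= M <S_n x, x> <= M <T x, x> <= M N |x|^2, and M + N is a bound
   for the square root of M N. *)
have [|n x|S SE] := bop_limit (C := M + N) _ _ c'; first by rewrite addr_ge0 ?ltW.
  have MN0 : 0 <= M + N by rewrite addr_ge0 ?ltW.
  rewrite -ler_sqr ?nnegrE ?mulr_ge0// (le_trans (AM _ _ _))//.
  apply: (@le_trans _ _ (M * (N * `|x| ^+ 2))).
    rewrite ler_pM2l// -ip_sum (le_trans _ (positive_ip_le bound_ge0 TN x))//.
    by move/op_leE: (psum_le n).
  rewrite exprMn mulrA ler_wpM2r ?exprn_ge0// -subr_ge0.
  rewrite (_ : _ - _ = M ^+ 2 + M * N + N ^+ 2); last by ring.
  by rewrite !addr_ge0 ?exprn_ge0 ?mulr_ge0 ?ltW.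
by exists S => x; rewrite SE.
Qed.
End positive_series.
End hilbert.

Theorem lemma4p2 (R : realType) (H : completeNormedModType R[i])
    (ip : {dot H for @Num.conj R[i]})
    (ip_norm : forall x : H, `|x| ^+ 2 = ip x x)
    (L : set (bounded_op H))
    (L_subspace : GRing.submod_closed (mem L : {pred bounded_op H}))
    (L_closed : strongly_closed L)
    (X : Type) (Omega : set (set X)) (Omega_algebra : set_algebra Omega)
    (mu : set X -> bounded_op H)
    (mu_pos : forall A : set X, Omega A -> sa_positive ip L (mu A))
    (mu0 : mu set0 = 0)
    (Delta : nat -> set X) (* Delta n is $\Delta_{n+1}$ *)
    (Omega_Delta : forall n : nat, Omega (Delta n))
    (Omega_bigcup : Omega (\bigcup_n Delta n)) :
  is_supremum_in ip (sa_part ip L)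
    [set \sum_(0 <= n < N.+1) mu (Delta n) | N in [set: nat]]
    (mu (\bigcup_n Delta n)) <->
  (forall x : H, [series mu (Delta n) x]_n @ \oo --> mu (\bigcup_n Delta n) x).
Proof.
pose A n := mu (Delta n); pose T := mu (\bigcup_n Delta n).
have A_sa n : selfadjoint ip (A n) by have [[]] := mu_pos _ (Omega_Delta n).
have A_ge0 n : op_le ip 0 (A n) by have [_] := mu_pos _ (Omega_Delta n).
have [[LT Tsa] T_ge0] : sa_positive ip L T := mu_pos _ Omega_bigcup.
have seriesE x : [series A n x]_n = (fun n => (\sum_(0 <= k < n) A k) x).
  by apply/funext => n; rewrite bop_sumE.
split.
  move=> [_ ub least].
  have psum_le n : op_le ip (\sum_(0 <= k < n) A k) T.
    by case: n => [|n]; [rewrite big_geq|apply: ub; exists n].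
  have [S AS] := psum_cvg ip_norm A_sa A_ge0 psum_le.
  suff ST : S = T by move=> x; rewrite -/T -ST seriesE.
  have LS : L S.
    apply: strongly_closed_cvg L_closed _ AS => n.
    have [L0 LD] := L_subspace.
    elim/big_ind: _ => [|P Q LP LQ|k _]; first exact/set_mem.
      by rewrite -[P]scale1r; apply/set_mem/LD; exact/mem_set.
    by have [[]] := mu_pos _ (Omega_Delta k).
  have Ssa : selfadjoint ip S.
    by apply: selfadjoint_limit AS => // n; exact: selfadjoint_sum.
  apply: (op_le_anti ip_norm) => //; first exact: limit_le_op AS.
  apply: least => // _ [n _ <-].
  by apply: (le_limit_op _ _ AS) => // *; exact: psum_nondecreasing.
move=> AT.
have AT' x : (fun n => (\sum_(0 <= k < n) A k) x) @ \oo --> T x.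
  by rewrite -seriesE; exact: AT.
split => // [_ [n _ <-]|U [_ Usa] Uub].
  by apply: (le_limit_op _ _ AT') => // *; exact: psum_nondecreasing.
(* The sums that U bounds are nonempty, those that converge to T start with
   the empty sum: compare with the next sum. *)
apply: (limit_le_op ip_norm _ AT') => n; apply/op_leE => x.
apply: le_trans (_ : ip ((\sum_(0 <= k < n.+1) A k) x) x <= _).
  by move: x; apply/op_leE; exact: psum_nondecreasing.
by move: x; apply/op_leE/Uub; exists n.
Qed.
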